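(* In the incircle family, from $X_1$ to $X_{200}$, the locus of the triangle center $X_k$ is an ellipse for $k=2, 3, 4, 5, 7, 8, 9, 10, 11, 12, 20, 21, 35, 36, 40, 46, 55, 56, 57, 63, 65, 72, 78, 79, 80, 84, 90, 100, 104, 119, 140, 142, 144, 145, 149, 153, 165, 191, 200$.
   Context: Incircle family: a family of Poncelet triangles interscribed in an external ellipse and a concentric internal circle. That is, the outer conic is an ellipse with semi-axes $a,b$, the inner conic is a circle with the same center whose radius is such that triangles exist which are inscribed in the ellipse and have all sides tangent to the circle (namely radius $ab/(a+b)$), and the family consists of all these triangles; every point of the outer ellipse is a vertex of one of them. The locus of a center is the set of its positions over all triangles of the family. Circles count as ellipses; an elliptic locus one or both of whose axes have shrunk to zero (a segment or a point) is called degenerate. Triangle centers (Kimberling's numbering). For a triangle with vertices $V_1,V_2,V_3$ and opposite sidelengths $s_1,s_2,s_3$, write $[h]$ for the point with homogeneous barycentric coordinates $h(s_1,s_2,s_3):h(s_2,s_3,s_1):h(s_3,s_1,s_2)$. In the formulas for $h(x,y,z)$ below, put $\kappa_x=\frac{y^2+z^2-x^2}{2yz}$, $\kappa_y=\frac{z^2+x^2-y^2}{2zx}$, $\kappa_z=\frac{x^2+y^2-z^2}{2xy}$ (cosines of the angles opposite $x,y,z$). Homogeneous coordinates with vanishing denominators are to be read after multiplying all three coordinates by the product of the three denominators. Equations between points are affine combinations. $X_1=[x]$ (incenter); $X_2=[1]$ (barycenter); $X_3=[x^2(y^2+z^2-x^2)]$ (circumcenter); $X_4=3X_2-2X_3$;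 $X_5=\frac12(3X_2-X_3)$; $X_7=[1/(y+z-x)]$; $X_8=[y+z-x]$; $X_9=[x(y+z-x)]$; $X_{10}=[y+z]$; $X_{11}=[(y-z)^2(y+z-x)]$; $X_{12}=[(y+z)^2/(y+z-x)]$; $X_{20}=4X_3-3X_2$; $X_{21}=[x(y+z-x)/(y+z)]$; $X_{35}=[x(1+2\kappa_x)]$; $X_{36}=[x(1-2\kappa_x)]$; $X_{40}=2X_3-X_1$; $X_{46}=[x(\kappa_y+\kappa_z-\kappa_x)]$; $X_{55}=[x^2(y+z-x)]$; $X_{56}=[x^2/(y+z-x)]$; $X_{57}=[x/(y+z-x)]$; $X_{63}=[x(y^2+z^2-x^2)]$; $X_{65}=[x(y+z)/(y+z-x)]$; $X_{72}=[x(y+z)(y^2+z^2-x^2)]$; $X_{78}=[x(y+z-x)(y^2+z^2-x^2)]$; $X_{79}=[1/(y^2+z^2-x^2+yz)]$; $X_{80}=2X_{11}-X_1$; $X_{84}=[x/(\kappa_y+\kappa_z-\kappa_x-1)]$; $X_{90}=[x/(\kappa_y+\kappa_z-\kappa_x)]$; $X_{100}=3X_2-2X_{11}$; $X_{104}=2X_3-X_{100}$; $X_{119}=2X_5-X_{11}$; $X_{140}=\frac12(X_3+X_5)$; $X_{142}=\frac12(3X_2-X_9)$; $X_{144}=3X_2-2X_7$; $X_{145}=3X_2-2X_8$; $X_{149}=3X_2-2X_{100}$; $X_{153}=3X_2-2X_{104}$; $X_{165}=\frac13(4X_3-X_1)$; $X_{191}=2X_{21}-X_1$; $X_{200}=[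x(y+z-x)^2]$.
   Formalization: The outer ellipse is assumed not to be a circle (else all triangles are equilateral and centers are fixed or undefined), and for k=90 the axis ratio √2−1 is excluded, since X_90 then has barycentrics of zero sum in every triangle and no finite locus. *)

(* Defs.v *)
From Stdlib Require Export Reals List.
Import ListNotations.
Open Scope R_scope.

Definition point : Type := (R * R)%type.

Definition padd (P Q : point) : point := (fst P + fst Q, snd P + snd Q).
Definition pscale (c : R) (P : point) : point := (c * fst P, c * snd P).

Definition distance (P Q : point) : R := dist_euc (fst P) (snd P) (fst Q) (snd Q).

Record Triangle : Type := mkTriangle { V1 : point; V2 : point; V3 : point }.

Definition noncollinear (P Q S : point) : Prop :=
  (fst Q - fst P) * (snd S - snd P) - (fst S - fst P) * (snd Q - snd P) <> 0.

(* The outer ellipse: semi-axes [a], [b] along the coordinate axes. *)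
Definition on_outer_ellipse (a b : R) (P : point) : Prop :=
  (fst P / a) ^ 2 + (snd P / b) ^ 2 = 1.

Definition on_inner_circle (r : R) (P : point) : Prop :=
  distance (0, 0) P = r.

(* The line through the distinct points [P], [Q] meets the circle in exactly
   one point. *)
Definition tangent_line (r : R) (P Q : point) : Prop :=
  exists! t : R, on_inner_circle r (padd (pscale (1 - t) P) (pscale t Q)).

Definition inradius (a b : R) : R := a * b / (a + b).

Definition incircle_family (a b : R) (T : Triangle) : Prop :=
  noncollinear (V1 T) (V2 T) (V3 T) /\
  on_outer_ellipse a b (V1 T) /\
  on_outer_ellipse a b (V2 T) /\
  on_outer_ellipse a b (V3 T) /\
  tangent_line (inradius a b) (V2 T) (V3 T) /\
  tangent_line (inradius a b) (V3 T) (V1 T) /\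
  tangent_line (inradius a b) (V1 T) (V2 T).

(* [X T P] says that [P] is the position of the center [X] in the triangle [T].
   A relation rather than a function, because homogeneous coordinates with
   zero sum (a point at infinity, or 0:0:0) determine no position. *)
Definition center : Type := Triangle -> point -> Prop.

(* The point [h], with coordinates h(s1,s2,s3) : h(s2,s3,s1) : h(s3,s1,s2). *)
Definition bary (h : R -> R -> R -> R) : center := fun T P =>
  let s1 := distance (V2 T) (V3 T) in
  let s2 := distance (V3 T) (V1 T) in
  let s3 := distance (V1 T) (V2 T) in
  let w1 := h s1 s2 s3 in
  let w2 := h s2 s3 s1 in
  let w3 := h s3 s1 s2 in
  w1 + w2 + w3 <> 0 /\
  P = pscale (/ (w1 + w2 + w3))
        (padd (pscale w1 (V1 T)) (padd (pscale w2 (V2 T)) (pscale w3 (V3 T)))).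

(* The point [n/d], its three coordinates multiplied by the product
   d(s1,s2,s3) d(s2,s3,s1) d(s3,s1,s2): this is the same point when no
   denominator vanishes, and the convention when one does. *)
Definition bary_frac (n d : R -> R -> R -> R) : center :=
  bary (fun x y z => n x y z * (d y z x * d z x y)).

(* The affine combination c X + d Y (used with c + d = 1). *)
Definition comb (c : R) (X : center) (d : R) (Y : center) : center := fun T P =>
  exists Q S : point, X T Q /\ Y T S /\ P = padd (pscale c Q) (pscale d S).

(* Cosine of the angle opposite [x]; the other two are [kappa y z x] and
   [kappa z x y]. *)
Definition kappa (x y z : R) : R := (y ^ 2 + z ^ 2 - x ^ 2) / (2 * y * z).

Definition X1 : center := bary (fun x y z => x).
Definition X2 : center := bary (fun x y z => 1).
Definition X3 : center := bary (fun x y z => x ^ 2 * (y ^ 2 + z ^ 2 - x ^ 2)).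
Definition X4 : center := comb 3 X2 (-2) X3.
Definition X5 : center := comb (3 / 2) X2 (- (1 / 2)) X3.
Definition X7 : center := bary_frac (fun x y z => 1) (fun x y z => y + z - x).
Definition X8 : center := bary (fun x y z => y + z - x).
Definition X9 : center := bary (fun x y z => x * (y + z - x)).
Definition X10 : center := bary (fun x y z => y + z).
Definition X11 : center := bary (fun x y z => (y - z) ^ 2 * (y + z - x)).
Definition X12 : center :=
  bary_frac (fun x y z => (y + z) ^ 2) (fun x y z => y + z - x).
Definition X20 : center := comb 4 X3 (-3) X2.
Definition X21 : center :=
  bary_frac (fun x y z => x * (y + z - x)) (fun x y z => y + z).
Definition X35 : center := bary (fun x y z => x * (1 + 2 * kappa x y z)).
Definition X36 : center := bary (fun x y z => x * (1 - 2 * kappa x y z)).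
Definition X40 : center := comb 2 X3 (-1) X1.
Definition X46 : center :=
  bary (fun x y z => x * (kappa y z x + kappa z x y - kappa x y z)).
Definition X55 : center := bary (fun x y z => x ^ 2 * (y + z - x)).
Definition X56 : center := bary_frac (fun x y z => x ^ 2) (fun x y z => y + z - x).
Definition X57 : center := bary_frac (fun x y z => x) (fun x y z => y + z - x).
Definition X63 : center := bary (fun x y z => x * (y ^ 2 + z ^ 2 - x ^ 2)).
Definition X65 : center :=
  bary_frac (fun x y z => x * (y + z)) (fun x y z => y + z - x).
Definition X72 : center :=
  bary (fun x y z => x * (y + z) * (y ^ 2 + z ^ 2 - x ^ 2)).
Definition X78 : center :=
  bary (fun x y z => x * (y + z - x) * (y ^ 2 + z ^ 2 - x ^ 2)).
Definition X79 : center :=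
  bary_frac (fun x y z => 1) (fun x y z => y ^ 2 + z ^ 2 - x ^ 2 + y * z).
Definition X80 : center := comb 2 X11 (-1) X1.
Definition X84 : center :=
  bary_frac (fun x y z => x)
            (fun x y z => kappa y z x + kappa z x y - kappa x y z - 1).
(* In the families with axis ratio sqrt 2 - 1, the ones containing right
   isosceles triangles, these coordinates have zero sum in every triangle. *)
Definition X90 : center :=
  bary_frac (fun x y z => x)
            (fun x y z => kappa y z x + kappa z x y - kappa x y z).
Definition X100 : center := comb 3 X2 (-2) X11.
Definition X104 : center := comb 2 X3 (-1) X100.
Definition X119 : center := comb 2 X5 (-1) X11.
Definition X140 : center := comb (1 / 2) X3 (1 / 2) X5.
Definition X142 : center := comb (3 / 2) X2 (- (1 / 2)) X9.
Definition X144 : center := comb 3 X2 (-2) X7.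
Definition X145 : center := comb 3 X2 (-2) X8.
Definition X149 : center := comb 3 X2 (-2) X100.
Definition X153 : center := comb 3 X2 (-2) X104.
Definition X165 : center := comb (4 / 3) X3 (- (1 / 3)) X1.
Definition X191 : center := comb 2 X21 (-1) X1.
Definition X200 : center := bary (fun x y z => x * (y + z - x) ^ 2).

Definition X (k : nat) : center :=
  match k with
  | 1 => X1 | 2 => X2 | 3 => X3 | 4 => X4 | 5 => X5 | 7 => X7 | 8 => X8
  | 9 => X9 | 10 => X10 | 11 => X11 | 12 => X12 | 20 => X20 | 21 => X21
  | 35 => X35 | 36 => X36 | 40 => X40 | 46 => X46 | 55 => X55 | 56 => X56
  | 57 => X57 | 63 => X63 | 65 => X65 | 72 => X72 | 78 => X78 | 79 => X79
  | 80 => X80 | 84 => X84 | 90 => X90 | 100 => X100 | 104 => X104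
  | 119 => X119 | 140 => X140 | 142 => X142 | 144 => X144 | 145 => X145
  | 149 => X149 | 153 => X153 | 165 => X165 | 191 => X191 | 200 => X200
  | _ => fun _ _ => False
  end%nat.

Definition locus (a b : R) (Y : center) (P : point) : Prop :=
  exists T : Triangle, incircle_family a b T /\ Y T P.

(* A non-degenerate ellipse, in arbitrary position: center [c], axes along the
   unit vector [u] and its rotation by a right angle, semi-axes [p] and [q]
   (possibly equal). *)
Definition is_ellipse (S : point -> Prop) : Prop :=
  exists (c u : point) (p q : R),
    fst u ^ 2 + snd u ^ 2 = 1 /\ 0 < p /\ 0 < q /\
    forall P : point,
      S P <->
      (((fst P - fst c) * fst u + (snd P - snd c) * snd u) / p) ^ 2 +
      (((snd P - snd c) * fst u - (fst P - fst c) * snd u) / q) ^ 2 = 1.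

(* Main.v *)
(* Each vertex is [(a p, b q)] with [(p, q)] a unit vector, and the opposite side
   is then the line [p X + q Y = - r] with [r = a b / (a + b)]. Hence the incenter
   is the origin and, writing [(P, Q)] for the sum of the three unit vectors, the
   barycenter is [(a P / 3, b Q / 3)] and the circumcenter is
   [(a + b) / 2 (P, Q)]. The point [(P, Q)] runs over the whole circle of radius
   [|a - b| / (a + b)], and the ratio of circumradius to inradius is the constant
   [(a + b)^2 / (2 a b)]. Every center of the list is a combination
   [beta X2 + gamma X3 + (1 - beta - gamma) X1] whose coefficients depend on that
   ratio only, so that its locus is an affine image of the circle. *)
Require Import Defs.
From Stdlib Require Import Reals List Lra.
Import ListNotations.
Open Scope R_scope.

(** * Tangency *)

Lemma sum_sq_0 (x y : R) : x ^ 2 + y ^ 2 = 0 -> x = 0 /\ y = 0.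
Proof. intros H; split; nra. Qed.

Lemma sum_sq_pos (x y : R) : ~ (x = 0 /\ y = 0) -> 0 < x ^ 2 + y ^ 2.
Proof.
intros H; destruct (Rle_lt_dec (x ^ 2 + y ^ 2) 0) as [Hle | Hlt]; [| exact Hlt].
exfalso; apply H, sum_sq_0; nra.
Qed.

Lemma distance_sq (P Q : point) :
  distance P Q ^ 2 = (fst P - fst Q) ^ 2 + (snd P - snd Q) ^ 2.
Proof.
unfold distance, dist_euc; rewrite pow2_sqrt.
- unfold Rsqr; ring.
- apply Rplus_le_le_0_compat; apply Rle_0_sqr.
Qed.

Lemma distance_nonneg (P Q : point) : 0 <= distance P Q.
Proof. apply sqrt_pos. Qed.

Lemma on_inner_circle_iff (r : R) (P : point) :
  0 < r -> on_inner_circle r P <-> fst P ^ 2 + snd P ^ 2 = r ^ 2.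
Proof.
intros hr; unfold on_inner_circle.
pose proof (distance_sq (0, 0) P) as E; pose proof (distance_nonneg (0, 0) P).
simpl fst in E; simpl snd in E; split; intros H0.
- rewrite H0 in E; lra.
- apply Rsqr_inj; unfold Rsqr; nra.
Qed.

(** Along the line the squared distance to the origin is [f t0 + D * (t - t0) ^ 2], where [t0] is
    the parameter of the foot of the perpendicular. The level [r ^ 2] is therefore hit exactly once
    when it is the minimum [f t0]. *)
Lemma tangent_line_iff (r : R) (P Q : point) : 0 < r -> P <> Q ->
  tangent_line r P Q <->
  (fst P * snd Q - fst Q * snd P) ^ 2 =
  r ^ 2 * ((fst Q - fst P) ^ 2 + (snd Q - snd P) ^ 2).
Proof.
intros hr hPQ; destruct P as [x y], Q as [x' y']; cbn [fst snd].
set (d := x' - x); set (e := y' - y).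
assert (hD : 0 < d ^ 2 + e ^ 2).
{ apply sum_sq_pos; intros [E1 E2]; apply hPQ; f_equal; unfold d, e in *; lra. }
set (D := d ^ 2 + e ^ 2) in *.
set (f := fun t => (x + t * d) ^ 2 + (y + t * e) ^ 2).
assert (Hf : forall t, on_inner_circle r
    (padd (pscale (1 - t) (x, y)) (pscale t (x', y'))) <-> f t = r ^ 2).
{ intros t; rewrite on_inner_circle_iff by exact hr; simpl; unfold f, d, e.
  split; intros E; rewrite <- E; ring. }
set (t0 := - (x * d + y * e) / D).
assert (H0 : D * f t0 = (x * y' - x' * y) ^ 2).
{ unfold f, t0, D, d, e in *; field; lra. }
assert (Hsq : forall t, f t = f t0 + D * (t - t0) ^ 2).
{ intros t; unfold f, t0, D, d, e in *; field; lra. }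
rewrite <- H0; split.
- intros [t [Ht Hu]].
  apply Hf in Ht.
  (* The mirror image of [t] in [t0] lies at the same distance, so uniqueness identifies the two. *)
  assert (E : t = 2 * t0 - t).
  { apply Hu, Hf; rewrite Hsq, <- Ht, (Hsq t); ring. }
  replace t0 with t by lra; rewrite Ht; ring.
- intros E; assert (E' : f t0 = r ^ 2) by nra.
  exists t0; split; [now apply Hf |].
  intros t Ht; apply Hf in Ht; rewrite Hsq, E' in Ht.
  assert ((t - t0) ^ 2 = 0) by nra; nra.
Qed.

(** The quadratic tangency condition splits off the factor [1 - (p * p' + q * q')], which vanishes
    only for equal unit vectors; the factor that remains is bilinear. *)
Lemma tangent_chord_iff (a b p q p' q' : R) :
  0 < a -> 0 < b -> p ^ 2 + q ^ 2 = 1 -> p' ^ 2 + q' ^ 2 = 1 ->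
  (p, q) <> (p', q') ->
  tangent_line (inradius a b) (a * p, b * q) (a * p', b * q') <->
  a * p * p' + b * q * q' = - inradius a b.
Proof.
intros ha hb h h' hne; unfold inradius.
rewrite tangent_line_iff; cbn [fst snd].
2: { apply Rdiv_lt_0_compat; nra. }
2: { intros E; inversion E; apply hne; f_equal;
     [apply Rmult_eq_reg_l with a | apply Rmult_eq_reg_l with b]; lra. }
assert (hA : 1 - (p * p' + q * q') <> 0).
{ intros E; destruct (sum_sq_0 (p - p') (q - q')) as [E1 E2]; [nra |].
  apply hne; f_equal; lra. }
(* For unit vectors at angles u and v, [h1], [h2] and [h3] express the squares of cos v - cos u, sin
   v - sin u and sin (v - u) by cos (u - v) and cos (u + v). *)
assert (h1 : (p' - p) ^ 2 =
  (1 - (p * p' + q * q')) * (1 - (p * p' - q * q'))).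
{ assert (Q : (q * q') ^ 2 = (1 - p ^ 2) * (1 - p' ^ 2)).
  { replace (1 - p ^ 2) with (q ^ 2) by lra.
    replace (1 - p' ^ 2) with (q' ^ 2) by lra; ring. }
  nra. }
assert (h2 : (q' - q) ^ 2 =
  (1 - (p * p' + q * q')) * (1 + (p * p' - q * q'))).
{ assert (Q : (p * p') ^ 2 = (1 - q ^ 2) * (1 - q' ^ 2)).
  { replace (1 - q ^ 2) with (p ^ 2) by lra.
    replace (1 - q' ^ 2) with (p' ^ 2) by lra; ring. }
  nra. }
assert (h3 : (p * q' - p' * q) ^ 2 =
  (1 - (p * p' + q * q')) * (1 + (p * p' + q * q'))).
{ assert ((p ^ 2 + q ^ 2) * (p' ^ 2 + q' ^ 2) = 1) by (rewrite h, h'; ring).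
  nra. }
assert (E : (a * p * (b * q') - a * p' * (b * q)) ^ 2 -
    (a * b / (a + b)) ^ 2 *
      ((a * p' - a * p) ^ 2 + (b * q' - b * q) ^ 2) =
  2 * (a * b) ^ 2 / (a + b) * (1 - (p * p' + q * q')) *
    (a * p * p' + b * q * q' - - (a * b / (a + b)))).
{ replace (a * p' - a * p) with (a * (p' - p)) by ring.
  replace (b * q' - b * q) with (b * (q' - q)) by ring.
  replace (a * p * (b * q') - a * p' * (b * q))
    with (a * b * (p * q' - p' * q)) by ring.
  rewrite !Rpow_mult_distr, h1, h2, h3; field; lra. }
assert (hc : 2 * (a * b) ^ 2 / (a + b) <> 0).
{ assert (0 < a * b) by nra.
  apply Rgt_not_eq, Rdiv_lt_0_compat; [| lra].
  apply Rmult_lt_0_compat; [lra | now apply pow_lt]. }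
split; intros H.
- rewrite H in E; rewrite Rminus_diag in E; symmetry in E.
  apply Rmult_integral in E; destruct E as [E | E]; [| lra].
  apply Rmult_integral in E; tauto.
- rewrite H in E; rewrite Rminus_diag, Rmult_0_r in E; lra.
Qed.

(** * The triangles of the family *)

Definition unit_vector (N : point) : Prop := fst N ^ 2 + snd N ^ 2 = 1.

Definition vertex (a b : R) (N : point) : point := (a * fst N, b * snd N).

(** For a unit vector [N] the equation puts the vertex of [N'] on the tangent of the circle that
    touches it at [- r N]; it is symmetric in [N] and [N']. *)
Definition conjugate (a b : R) (N N' : point) : Prop :=
  N <> N' /\ a * fst N * fst N' + b * snd N * snd N' = - inradius a b.

Definition poncelet (a b : R) (N1 N2 N3 : point) : Prop :=
  unit_vector N1 /\ unit_vector N2 /\ unit_vector N3 /\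
  conjugate a b N1 N2 /\ conjugate a b N2 N3 /\ conjugate a b N3 N1.

Lemma poncelet_cyclic (a b : R) (N1 N2 N3 : point) :
  poncelet a b N1 N2 N3 -> poncelet a b N2 N3 N1.
Proof. unfold poncelet; tauto. Qed.

Lemma inradius_pos (a b : R) : 0 < a -> 0 < b -> 0 < inradius a b.
Proof. intros; apply Rdiv_lt_0_compat; nra. Qed.

Lemma inradius_mult (a b : R) : 0 < a -> 0 < b ->
  inradius a b * (a + b) = a * b.
Proof. intros; unfold inradius; field; lra. Qed.

(** The signed length of the side opposite the first vertex: the component of the vector from the
    second vertex to the third along [N1] turned by a right angle. *)
Definition side (a b : R) (N1 N2 N3 : point) : R :=
  b * (snd N3 - snd N2) * fst N1 - a * (fst N3 - fst N2) * snd N1.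

(** Subtracting the two conjugacy relations of [N1] shows that this side is orthogonal to [N1]. *)
Lemma side_spec (a b : R) (N1 N2 N3 : point) : poncelet a b N1 N2 N3 ->
  a * (fst N3 - fst N2) = - side a b N1 N2 N3 * snd N1 /\
  b * (snd N3 - snd N2) = side a b N1 N2 N3 * fst N1.
Proof.
intros (u1 & _ & _ & [_ c12] & _ & [_ c31]).
destruct N1 as [p1 q1], N2 as [p2 q2], N3 as [p3 q3].
unfold unit_vector, side in *; cbn [fst snd] in *.
assert (h : p1 * (a * (p3 - p2)) + q1 * (b * (q3 - q2)) = 0) by lra.
revert h; generalize (a * (p3 - p2)) (b * (q3 - q2)); intros A B h.
split; apply Rminus_diag_uniq.
- transitivity (p1 * (p1 * A + q1 * B) - A * (p1 ^ 2 + q1 ^ 2 - 1));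
    [ring | rewrite h, u1; ring].
- transitivity (q1 * (p1 * A + q1 * B) - B * (p1 ^ 2 + q1 ^ 2 - 1));
    [ring | rewrite h, u1; ring].
Qed.

(** Twice the signed area of the triangle of vertices. *)
Definition turn (a b : R) (N1 N2 N3 : point) : R :=
  a * b * ((fst N2 - fst N1) * (snd N3 - snd N1)
           - (fst N3 - fst N1) * (snd N2 - snd N1)).

(** Base times height: the last factor is the distance from the first vertex to the opposite side.
    As heights are positive, all three signed sides have the sign opposite to that of [turn]. *)
Lemma turn_side (a b : R) (N1 N2 N3 : point) : poncelet a b N1 N2 N3 ->
  turn a b N1 N2 N3 =
  - side a b N1 N2 N3 *
    (a * fst N1 ^ 2 + b * snd N1 ^ 2 + inradius a b).
Proof.
intros hP; destruct (side_spec _ _ _ _ _ hP) as [E1 E2].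
destruct hP as (u1 & _ & _ & [_ c12] & _ & [_ c31]).
transitivity (a * (fst N3 - fst N2) * (b * (snd N1 - snd N2))
   - b * (snd N3 - snd N2) * (a * (fst N1 - fst N2))).
- unfold turn; ring.
- rewrite E1, E2, <- (Ropp_involutive (inradius a b)), <- c12; ring.
Qed.

Lemma perp_parallel (d e x y x' y' : R) : ~ (d = 0 /\ e = 0) ->
  d * x + e * y = 0 -> d * x' + e * y' = 0 -> x * y' = x' * y.
Proof.
intros hde h h'.
assert (E1 : d * (x * y' - x' * y) = 0).
{ transitivity ((d * x + e * y) * y' - (d * x' + e * y') * y);
    [ring | rewrite h, h'; ring]. }
assert (E2 : e * (x * y' - x' * y) = 0).
{ transitivity (x * (d * x' + e * y') - x' * (d * x + e * y));
    [ring | rewrite h, h'; ring]. }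
apply Rmult_integral in E1, E2; lra.
Qed.

(** The special radius enters through [a * b = r * (a + b)], which makes the squared norm of the
    vertex factor; positivity follows because the vertex is not the origin. *)
Lemma vertex_norm (a b : R) (N : point) : 0 < a -> 0 < b -> unit_vector N ->
  0 < a * fst N ^ 2 + b * snd N ^ 2 - inradius a b /\
  (a * fst N) ^ 2 + (b * snd N) ^ 2 =
  (a + b) * (a * fst N ^ 2 + b * snd N ^ 2 - inradius a b).
Proof.
intros ha hb; destruct N as [p q]; unfold unit_vector; cbn [fst snd]; intros u.
pose proof (inradius_mult a b ha hb) as hr.
assert (E : (a * p) ^ 2 + (b * q) ^ 2 =
  (a + b) * (a * p ^ 2 + b * q ^ 2 - inradius a b)).
{ transitivity ((a * p) ^ 2 + (b * q) ^ 2 + a * b * (p ^ 2 + q ^ 2 - 1));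
    [rewrite u; ring |].
  transitivity ((a + b) * (a * p ^ 2 + b * q ^ 2) - a * b); [ring |].
  rewrite <- hr; ring. }
split; [| exact E].
assert (hpos : 0 < (a * p) ^ 2 + (b * q) ^ 2).
{ apply sum_sq_pos; intros [E1 E2].
  apply Rmult_integral in E1, E2.
  replace p with 0 in u by lra; replace q with 0 in u by lra; lra. }
rewrite E in hpos; nra.
Qed.

(* [N2 - N3] is orthogonal both to the vertex [V1] and to [N2 + N3], so that
   [N2 + N3] is a multiple of [V1]. *)
Lemma conjugate_sum (a b : R) (N1 N2 N3 : point) : 0 < a -> 0 < b ->
  poncelet a b N1 N2 N3 ->
  let k := (a + b) * (a * fst N1 ^ 2 + b * snd N1 ^ 2 - inradius a b) in
  fst N2 + fst N3 = - 2 * inradius a b * (a * fst N1) / k /\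
  snd N2 + snd N3 = - 2 * inradius a b * (b * snd N1) / k.
Proof.
intros ha hb (u1 & u2 & u3 & [_ c12] & [n23 _] & [_ c31]) k.
destruct (vertex_norm a b N1 ha hb u1) as [hM E]; fold k in E.
assert (hk : 0 < k) by (apply Rmult_lt_0_compat; lra).
clearbody k; clear hM.
destruct N1 as [p1 q1], N2 as [p2 q2], N3 as [p3 q3].
unfold unit_vector in *; cbn [fst snd] in *.
set (r := inradius a b) in *; clearbody r.
assert (hpar : (p2 + p3) * (b * q1) = (a * p1) * (q2 + q3)).
{ apply perp_parallel with (p2 - p3) (q2 - q3); [| lra | lra].
  intros [E1 E2]; apply n23; f_equal; lra. }
assert (hdot : (p2 + p3) * (a * p1) + (q2 + q3) * (b * q1) = - 2 * r) by lra.
split; apply Rmult_eq_reg_r with k; try lra; rewrite <- E at 1.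
- transitivity ((a * p1) * ((p2 + p3) * (a * p1) + (q2 + q3) * (b * q1))
    + (b * q1) * ((p2 + p3) * (b * q1) - (a * p1) * (q2 + q3))); [ring |].
  rewrite hpar, hdot; field; lra.
- transitivity ((b * q1) * ((p2 + p3) * (a * p1) + (q2 + q3) * (b * q1))
    - (a * p1) * ((p2 + p3) * (b * q1) - (a * p1) * (q2 + q3))); [ring |].
  rewrite hpar, hdot; field; lra.
Qed.

(** By [conjugate_sum] the sum of the normals is a function of [N1] alone. In its squared norm the
    terms in [1 / m] cancel, since the squared norm of the vertex is [(a + b) * m], and
    [1 - 4 * r / (a + b)] remains. *)
Lemma center_norm (a b : R) (N1 N2 N3 : point) : 0 < a -> 0 < b ->
  poncelet a b N1 N2 N3 ->
  (fst N1 + fst N2 + fst N3) ^ 2 + (snd N1 + snd N2 + snd N3) ^ 2 =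
  ((a - b) / (a + b)) ^ 2.
Proof.
intros ha hb hP; destruct (conjugate_sum a b N1 N2 N3 ha hb hP) as [E1 E2].
destruct hP as (u1 & _).
destruct (vertex_norm a b N1 ha hb u1) as [hM E].
pose proof (inradius_mult a b ha hb) as hr.
rewrite !Rplus_assoc, E1, E2.
destruct N1 as [p q]; unfold unit_vector in *; cbn [fst snd] in *.
set (r := inradius a b) in *.
set (m := a * p ^ 2 + b * q ^ 2 - r) in *.
transitivity (p ^ 2 + q ^ 2 - 4 * r * (m + r) / ((a + b) * m)
  + 4 * r ^ 2 * ((a * p) ^ 2 + (b * q) ^ 2) / ((a + b) * m) ^ 2).
- unfold m in *; field; lra.
- rewrite E, u1; replace r with (a * b / (a + b)) by reflexivity.
  field; lra.
Qed.

(** The sum of the normals is invariant under cyclic shifts, so treating the first vertex is enough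
    to identify the circumcenter and the circumradius [(a + b) / 2]. *)
Lemma circumcenter_dist (a b : R) (N1 N2 N3 : point) : 0 < a -> 0 < b ->
  poncelet a b N1 N2 N3 ->
  ((a + b) / 2 * (fst N1 + fst N2 + fst N3) - a * fst N1) ^ 2 +
  ((a + b) / 2 * (snd N1 + snd N2 + snd N3) - b * snd N1) ^ 2 =
  ((a + b) / 2) ^ 2.
Proof.
intros ha hb hP; destruct (conjugate_sum a b N1 N2 N3 ha hb hP) as [E1 E2].
destruct hP as (u1 & _).
destruct (vertex_norm a b N1 ha hb u1) as [hM E].
pose proof (inradius_mult a b ha hb) as hr.
rewrite !Rplus_assoc, E1, E2.
destruct N1 as [p q]; unfold unit_vector in *; cbn [fst snd] in *.
set (r := inradius a b) in *.
set (m := a * p ^ 2 + b * q ^ 2 - r) in *.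
transitivity (((a - b) / 2) ^ 2 * (p ^ 2 + q ^ 2)
  + r * (a - b) * (a * p ^ 2 - b * q ^ 2) / m
  + r ^ 2 * ((a * p) ^ 2 + (b * q) ^ 2) / m ^ 2).
- field; lra.
- rewrite E, u1.
  assert (E' : (a - b) * (a * p ^ 2 - b * q ^ 2) = (a + b) * m - a * b).
  { rewrite <- E; transitivity ((a * p) ^ 2 + (b * q) ^ 2 -
      a * b * (p ^ 2 + q ^ 2)); [ring | rewrite u1; ring]. }
  rewrite (Rmult_assoc r), E', <- hr.
  transitivity (((a - b) / 2) ^ 2 + r * (a + b)); [field; lra |].
  rewrite hr; field.
Qed.

Lemma side_neq_0 (a b : R) (N1 N2 N3 : point) : 0 < a -> 0 < b ->
  poncelet a b N1 N2 N3 -> side a b N1 N2 N3 <> 0.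
Proof.
intros ha hb hP E; destruct (side_spec _ _ _ _ _ hP) as [E1 E2].
rewrite E in E1, E2; destruct hP as (_ & _ & _ & _ & [hne _] & _).
apply hne; destruct N2, N3; cbn [fst snd] in *; f_equal.
- apply Rmult_eq_reg_l with a; lra.
- apply Rmult_eq_reg_l with b; lra.
Qed.

(** Noncollinear vertices have distinct normals, so each tangency becomes a conjugacy; conversely,
    [turn_side] yields a nonzero area. *)
Lemma incircle_family_iff (a b : R) (N1 N2 N3 : point) : 0 < a -> 0 < b ->
  incircle_family a b
    (mkTriangle (vertex a b N1) (vertex a b N2) (vertex a b N3)) <->
  poncelet a b N1 N2 N3.
Proof.
intros ha hb.
assert (hell : forall N, on_outer_ellipse a b (vertex a b N) <-> unit_vector N).
{ intros [p q]; unfold on_outer_ellipse, vertex, unit_vector; cbn [fst snd].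
  replace (a * p / a) with p by (field; lra).
  replace (b * q / b) with q by (field; lra); reflexivity. }
assert (hturn : noncollinear (vertex a b N1) (vertex a b N2) (vertex a b N3)
    <-> turn a b N1 N2 N3 <> 0).
{ unfold noncollinear, turn, vertex; cbn [fst snd].
  match goal with |- ?l <> 0 <-> ?r <> 0 => replace l with r by ring end.
  reflexivity. }
assert (htan : forall N N', unit_vector N -> unit_vector N' -> N <> N' ->
  tangent_line (inradius a b) (vertex a b N) (vertex a b N') <->
  conjugate a b N N').
{ intros [p q] [p' q'] u u' hne; unfold conjugate, vertex; cbn [fst snd].
  rewrite tangent_chord_iff by assumption; tauto. }
unfold incircle_family; cbn [V1 V2 V3]; rewrite hturn, !hell; split.
- intros (ht & u1 & u2 & u3 & t23 & t31 & t12).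
  assert (n12 : N1 <> N2) by (intros ->; apply ht; unfold turn; ring).
  assert (n23 : N2 <> N3) by (intros ->; apply ht; unfold turn; ring).
  assert (n31 : N3 <> N1) by (intros ->; apply ht; unfold turn; ring).
  rewrite htan in t12, t23, t31 by assumption.
  unfold poncelet; tauto.
- intros hP; split.
  + rewrite turn_side by exact hP.
    pose proof (side_neq_0 _ _ _ _ _ ha hb hP).
    assert (0 < a * fst N1 ^ 2 + b * snd N1 ^ 2 + inradius a b).
    { destruct hP as (u1 & _).
      pose proof (vertex_norm a b N1 ha hb u1).
      pose proof (inradius_pos a b ha hb); lra. }
    apply Rmult_integral_contrapositive; split; lra.
  + destruct hP as (u1 & u2 & u3 & c12 & c23 & c31).
    rewrite !htan by (assumption || apply c12 || apply c23 || apply c31).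
    tauto.
Qed.

Lemma incircle_family_poncelet (a b : R) (T : Triangle) : 0 < a -> 0 < b ->
  incircle_family a b T -> exists N1 N2 N3, poncelet a b N1 N2 N3 /\
  T = mkTriangle (vertex a b N1) (vertex a b N2) (vertex a b N3).
Proof.
intros ha hb hT; destruct T as [[x1 y1] [x2 y2] [x3 y3]].
exists (x1 / a, y1 / b), (x2 / a, y2 / b), (x3 / a, y3 / b).
assert (E : forall x y, (x, y) = vertex a b (x / a, y / b)).
{ intros x y; unfold vertex; cbn [fst snd]; f_equal; field; lra. }
rewrite <- incircle_family_iff, <- !E by assumption; auto.
Qed.

Lemma poncelet_sides (a b : R) (N1 N2 N3 : point) : 0 < a -> 0 < b ->
  poncelet a b N1 N2 N3 -> exists e, (e = 1 \/ e = -1) /\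
  distance (vertex a b N2) (vertex a b N3) = e * side a b N1 N2 N3 /\
  distance (vertex a b N3) (vertex a b N1) = e * side a b N2 N3 N1 /\
  distance (vertex a b N1) (vertex a b N2) = e * side a b N3 N1 N2 /\
  0 < e * side a b N1 N2 N3 /\
  0 < e * side a b N2 N3 N1 /\
  0 < e * side a b N3 N1 N2.
Proof.
intros ha hb.
(* The orientation: [turn] is invariant under cyclic shifts, so one sign makes all three signed
   sides positive. *)
set (e := if Rlt_dec (turn a b N1 N2 N3) 0 then 1 else -1).
assert (he : e = 1 \/ e = -1) by (unfold e; destruct Rlt_dec; auto).
assert (main : forall M1 M2 M3, poncelet a b M1 M2 M3 ->
  turn a b M1 M2 M3 = turn a b N1 N2 N3 ->
  0 < e * side a b M1 M2 M3 /\
  distance (vertex a b M2) (vertex a b M3) = e * side a b M1 M2 M3).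
{ intros M1 M2 M3 hM ht.
  assert (hpos : 0 < e * side a b M1 M2 M3).
  { pose proof (turn_side _ _ _ _ _ hM) as E; rewrite ht in E.
    pose proof (side_neq_0 _ _ _ _ _ ha hb hM).
    pose proof (inradius_pos a b ha hb).
    destruct (vertex_norm a b M1 ha hb) as [hv _]; [apply hM |].
    unfold e; destruct Rlt_dec; nra. }
  split; [exact hpos |].
  apply Rsqr_inj; [apply distance_nonneg | lra |].
  rewrite !Rsqr_pow2, distance_sq; unfold vertex; cbn [fst snd].
  destruct (side_spec _ _ _ _ _ hM) as [E1 E2].
  transitivity ((a * (fst M3 - fst M2)) ^ 2 + (b * (snd M3 - snd M2)) ^ 2);
    [ring |].
  rewrite E1, E2, (Rpow_mult_distr e).
  replace (e ^ 2) with 1 by (destruct he as [-> | ->]; ring).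
  transitivity (side a b M1 M2 M3 ^ 2 * (fst M1 ^ 2 + snd M1 ^ 2)); [ring |].
  destruct hM as [u1 _]; rewrite u1; ring. }
intros hP; exists e.
pose proof (poncelet_cyclic _ _ _ _ _ hP) as hP'.
pose proof (poncelet_cyclic _ _ _ _ _ hP') as hP''.
destruct (main _ _ _ hP) as [? ?]; [unfold turn; ring |].
destruct (main _ _ _ hP') as [? ?]; [unfold turn; ring |].
destruct (main _ _ _ hP'') as [? ?]; [unfold turn; ring |].
tauto.
Qed.

(** The angle at the first vertex is supplementary to the angle between [N2] and [N3], the normals
    of the sides meeting there; this accounts for the minus sign. *)
Lemma law_of_cosines (a b : R) (N1 N2 N3 : point) : poncelet a b N1 N2 N3 ->
  side a b N2 N3 N1 ^ 2 + side a b N3 N1 N2 ^ 2 - side a b N1 N2 N3 ^ 2 =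
  - 2 * side a b N2 N3 N1 * side a b N3 N1 N2 *
    (fst N2 * fst N3 + snd N2 * snd N3).
Proof.
intros hP.
assert (sq : forall M1 M2 M3, poncelet a b M1 M2 M3 -> side a b M1 M2 M3 ^ 2 =
  (a * (fst M3 - fst M2)) ^ 2 + (b * (snd M3 - snd M2)) ^ 2).
{ intros M1 M2 M3 hM; destruct (side_spec _ _ _ _ _ hM) as [E1 E2].
  rewrite E1, E2; destruct hM as [u1 _].
  transitivity (side a b M1 M2 M3 ^ 2 * (fst M1 ^ 2 + snd M1 ^ 2)); [|ring].
  rewrite u1; ring. }
pose proof (poncelet_cyclic _ _ _ _ _ hP) as hP'.
pose proof (poncelet_cyclic _ _ _ _ _ hP') as hP''.
rewrite (sq _ _ _ hP), (sq _ _ _ hP'), (sq _ _ _ hP'').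
destruct (side_spec _ _ _ _ _ hP') as [E1 E2].
destruct (side_spec _ _ _ _ _ hP'') as [E3 E4].
transitivity (- 2 * (a * (fst N1 - fst N3)) * (a * (fst N2 - fst N1)) -
  2 * (b * (snd N1 - snd N3)) * (b * (snd N2 - snd N1))); [ring |].
rewrite E1, E2, E3, E4; ring.
Qed.

Lemma tangent_lengths (x y z : R) : 0 < x -> 0 < y -> 0 < z ->
  x < y + z -> y < z + x -> z < x + y ->
  exists t1 t2 t3, 0 < t1 /\ 0 < t2 /\ 0 < t3 /\
  x = t2 + t3 /\ y = t3 + t1 /\ z = t1 + t2.
Proof.
intros; exists ((y + z - x) / 2), ((z + x - y) / 2), ((x + y - z) / 2); lra.
Qed.

(* The circumradius [(a + b) / 2] over the inradius [a b / (a + b)]. *)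
Definition ratio (a b : R) : R := (a + b) ^ 2 / (2 * a * b).

(** [center_norm] fixes the sum of the pairwise products of the normals, hence the sum of the three
    cosines, which determines the ratio of circumradius to inradius. *)
Lemma poncelet_tangent_lengths (a b : R) (N1 N2 N3 : point) :
  0 < a -> 0 < b -> poncelet a b N1 N2 N3 ->
  exists t1 t2 t3, 0 < t1 /\ 0 < t2 /\ 0 < t3 /\
  distance (vertex a b N2) (vertex a b N3) = t2 + t3 /\
  distance (vertex a b N3) (vertex a b N1) = t3 + t1 /\
  distance (vertex a b N1) (vertex a b N2) = t1 + t2 /\
  (t1 + t2) * (t2 + t3) * (t3 + t1) = 4 * ratio a b * (t1 * t2 * t3).
Proof.
intros ha hb hP.
pose proof (poncelet_cyclic _ _ _ _ _ hP) as hP'.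
pose proof (poncelet_cyclic _ _ _ _ _ hP') as hP''.
destruct (poncelet_sides _ _ _ _ _ ha hb hP)
  as (e & he & -> & -> & -> & h1 & h2 & h3).
assert (cosines : forall M1 M2 M3, poncelet a b M1 M2 M3 ->
  (e * side a b M2 M3 M1) ^ 2 + (e * side a b M3 M1 M2) ^ 2
    - (e * side a b M1 M2 M3) ^ 2 =
  - 2 * (e * side a b M2 M3 M1) * (e * side a b M3 M1 M2) *
    (fst M2 * fst M3 + snd M2 * snd M3) /\
  fst M2 * fst M3 + snd M2 * snd M3 < 1).
{ intros M1 M2 M3 hM; split.
  - rewrite !Rpow_mult_distr.
    transitivity (e ^ 2 * (side a b M2 M3 M1 ^ 2 + side a b M3 M1 M2 ^ 2
      - side a b M1 M2 M3 ^ 2)); [ring |].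
    rewrite law_of_cosines by exact hM; ring.
  - destruct hM as (_ & u2 & u3 & _ & [hne _] & _); unfold unit_vector in *.
    destruct M2 as [p q], M3 as [p' q']; cbn [fst snd] in *.
    assert (0 < (p - p') ^ 2 + (q - q') ^ 2); [| nra].
    apply sum_sq_pos; intros [? ?]; apply hne; f_equal; lra. }
destruct (cosines _ _ _ hP) as [C1 L1].
destruct (cosines _ _ _ hP') as [C2 L2].
destruct (cosines _ _ _ hP'') as [C3 L3].
pose proof (center_norm _ _ _ _ _ ha hb hP) as hn.
destruct hP as (u1 & u2 & u3 & _); unfold unit_vector in *.
set (x := e * side a b N1 N2 N3) in *.
set (y := e * side a b N2 N3 N1) in *.
set (z := e * side a b N3 N1 N2) in *.
set (k1 := fst N2 * fst N3 + snd N2 * snd N3) in *.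
set (k2 := fst N3 * fst N1 + snd N3 * snd N1) in *.
set (k3 := fst N1 * fst N2 + snd N1 * snd N2) in *.
(* The left side is the sum of the cosines of the angles, and the squared norm of the sum of the
   normals is [3 + 2 * (k1 + k2 + k3)]. *)
assert (hk : - (k1 + k2 + k3) = 1 + / ratio a b).
{ unfold ratio; transitivity ((3 - ((a - b) / (a + b)) ^ 2) / 2);
    [| field; lra].
  rewrite <- hn; unfold k1, k2, k3; lra. }
assert (triangle : forall x y z k, 0 < x -> 0 < y -> 0 < z -> k < 1 ->
  y ^ 2 + z ^ 2 - x ^ 2 = - 2 * y * z * k -> x < y + z).
{ clear; intros x y z k hx hy hz hk E.
  assert (0 < y * z * (1 - k)) by (repeat apply Rmult_lt_0_compat; lra).
  nra. }
destruct (tangent_lengths x y z) as (t1 & t2 & t3 & h); try assumption.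
{ now apply (triangle x y z k1). }
{ now apply (triangle y z x k2). }
{ now apply (triangle z x y k3). }
exists t1, t2, t3; destruct h as (p1 & p2 & p3 & Ex & Ey & Ez).
repeat (split; [assumption |]).
clearbody x y z k1 k2 k3; clear - ha hb C1 C2 C3 hk p1 p2 p3 Ex Ey Ez.
assert (hr : 0 < ratio a b).
{ unfold ratio; apply Rdiv_lt_0_compat; [apply pow_lt; lra |].
  apply Rmult_lt_0_compat; lra. }
set (rho := ratio a b) in *; clearbody rho.
(* The law of cosines turns the left side into [(y + z - x) * (z + x - y) * (x + y - z)]. *)
assert (E : 2 * x * y * z * (- (k1 + k2 + k3) - 1) = 8 * (t1 * t2 * t3)).
{ transitivity (x * (- 2 * y * z * k1) + y * (- 2 * z * x * k2)
    + z * (- 2 * x * y * k3) - 2 * x * y * z); [ring |].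
  rewrite <- C1, <- C2, <- C3, Ex, Ey, Ez; ring. }
rewrite hk in E; rewrite <- Ex, <- Ey, <- Ez.
transitivity (rho * (2 * x * y * z * (1 + / rho - 1)) / 2);
  [field; lra | rewrite E; field].
Qed.

(** Up to a common sign each term is an edge vector turned by a right angle, and the edges sum to
    zero. Scaling the coordinates by [a] and [b] places the incenter at the origin. *)
Lemma poncelet_incenter (a b : R) (N1 N2 N3 : point) : 0 < a -> 0 < b ->
  poncelet a b N1 N2 N3 ->
  let s1 := distance (vertex a b N2) (vertex a b N3) in
  let s2 := distance (vertex a b N3) (vertex a b N1) in
  let s3 := distance (vertex a b N1) (vertex a b N2) in
  s1 * fst N1 + s2 * fst N2 + s3 * fst N3 = 0 /\
  s1 * snd N1 + s2 * snd N2 + s3 * snd N3 = 0.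
Proof.
intros ha hb hP s1 s2 s3; unfold s1, s2, s3.
destruct (poncelet_sides _ _ _ _ _ ha hb hP)
  as (e & _ & -> & -> & -> & _).
pose proof (poncelet_cyclic _ _ _ _ _ hP) as hP'.
pose proof (poncelet_cyclic _ _ _ _ _ hP') as hP''.
destruct (side_spec _ _ _ _ _ hP) as [E1 F1].
destruct (side_spec _ _ _ _ _ hP') as [E2 F2].
destruct (side_spec _ _ _ _ _ hP'') as [E3 F3].
rewrite !Rmult_assoc, <- !Rmult_plus_distr_l.
split; apply Rmult_eq_0_compat_l; nra.
Qed.

(** * Centers as combinations of X1, X2 and X3 *)

(** Differences of the equidistance equations are linear in the center ([F2], [F3]), and Cramer's
    rule with determinant [D], twice the signed area, solves them. *)
Lemma circumcenter_bary (x1 y1 x2 y2 x3 y3 x y R2 d1 d2 d3 : R) :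
  (x - x1) ^ 2 + (y - y1) ^ 2 = R2 ->
  (x - x2) ^ 2 + (y - y2) ^ 2 = R2 ->
  (x - x3) ^ 2 + (y - y3) ^ 2 = R2 ->
  d1 = (x2 - x3) ^ 2 + (y2 - y3) ^ 2 ->
  d2 = (x3 - x1) ^ 2 + (y3 - y1) ^ 2 ->
  d3 = (x1 - x2) ^ 2 + (y1 - y2) ^ 2 ->
  let w1 := d1 * (d2 + d3 - d1) in
  let w2 := d2 * (d3 + d1 - d2) in
  let w3 := d3 * (d1 + d2 - d3) in
  w1 * x1 + w2 * x2 + w3 * x3 = (w1 + w2 + w3) * x /\
  w1 * y1 + w2 * y2 + w3 * y3 = (w1 + w2 + w3) * y.
Proof.
intros e1 e2 e3 E1 E2 E3 w1 w2 w3.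
set (D := (x2 - x1) * (y3 - y1) - (x3 - x1) * (y2 - y1)).
assert (F2 : 2 * ((x2 - x1) * (x - x1) + (y2 - y1) * (y - y1)) = d3)
  by (rewrite E3; lra).
assert (F3 : 2 * ((x3 - x1) * (x - x1) + (y3 - y1) * (y - y1)) = d2)
  by (rewrite E2; lra).
assert (Hw : w1 + w2 + w3 = 4 * D ^ 2)
  by (unfold w1, w2, w3, D; rewrite E1, E2, E3; ring).
split.
- transitivity ((w1 + w2 + w3) * x1 + w2 * (x2 - x1) + w3 * (x3 - x1));
    [ring |].
  transitivity ((w1 + w2 + w3) * x1
    + 2 * D * (d3 * (y3 - y1) - d2 * (y2 - y1))).
  + unfold w2, w3, D; rewrite E1, E2, E3; ring.
  + rewrite Hw, <- F2, <- F3; unfold D; ring.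
- transitivity ((w1 + w2 + w3) * y1 + w2 * (y2 - y1) + w3 * (y3 - y1));
    [ring |].
  transitivity ((w1 + w2 + w3) * y1
    + 2 * D * (d2 * (x2 - x1) - d3 * (x3 - x1))).
  + unfold w2, w3, D; rewrite E1, E2, E3; ring.
  + rewrite Hw, <- F2, <- F3; unfold D; ring.
Qed.

(* In a triangle with tangent lengths [t1], [t2], [t3] and circumradius to
   inradius ratio [rho], the point [h] is
   [beta X2 + gamma X3 + (1 - beta - gamma) X1]. *)
Definition central (rho : R) (h : R -> R -> R -> R) (beta gamma : R) : Prop :=
  forall t1 t2 t3 : R, 0 < t1 -> 0 < t2 -> 0 < t3 ->
  (t1 + t2) * (t2 + t3) * (t3 + t1) = 4 * rho * (t1 * t2 * t3) ->
  let x := t2 + t3 in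
  let y := t3 + t1 in
  let z := t1 + t2 in
  let W := h x y z + h y z x + h z x y in
  W <> 0 /\
  h x y z = W * (beta / 3
    + gamma * (x ^ 2 * (y ^ 2 + z ^ 2 - x ^ 2))
      / (16 * (t1 + t2 + t3) * (t1 * t2 * t3))
    + (1 - beta - gamma) * x / (2 * (t1 + t2 + t3))).

(** The factor of the first coordinate of the sum of normals in [beta X2 + gamma X3], with X1 at the
    origin; exchanging [a] and [b] gives the factor of the second. *)
Definition axis (beta gamma a b : R) : R :=
  beta * (a / 3) + gamma * ((a + b) / 2).

(** The equivalence provides both existence and uniqueness of the position. *)
Definition located (a b : R) (Y : center) (beta gamma : R) : Prop :=
  forall N1 N2 N3 : point, poncelet a b N1 N2 N3 -> forall P : point,
  Y (mkTriangle (vertex a b N1) (vertex a b N2) (vertex a b N3)) P <->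
  P = (axis beta gamma a b * (fst N1 + fst N2 + fst N3),
       axis beta gamma b a * (snd N1 + snd N2 + snd N3)).

Lemma located_comb (a b c d : R) (Y Z : center) (beta gamma beta' gamma' : R) :
  located a b Y beta gamma -> located a b Z beta' gamma' ->
  located a b (comb c Y d Z) (c * beta + d * beta') (c * gamma + d * gamma').
Proof.
intros hY hZ N1 N2 N3 hP P; specialize (hY _ _ _ hP); specialize (hZ _ _ _ hP).
unfold comb; split.
- intros (Q & S & hQ & hS & ->); apply hY in hQ; apply hZ in hS.
  rewrite hQ, hS; unfold padd, pscale, axis; cbn [fst snd]; f_equal; ring.
- intros ->; eexists; eexists; split; [apply hY; reflexivity |].
  split; [apply hZ; reflexivity |].
  unfold padd, pscale, axis; cbn [fst snd]; f_equal; ring.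
Qed.

Lemma located_bary (a b : R) (h : R -> R -> R -> R) (beta gamma : R) :
  0 < a -> 0 < b -> central (ratio a b) h beta gamma ->
  located a b (bary h) beta gamma.
Proof.
intros ha hb hc N1 N2 N3 hP.
pose proof (poncelet_cyclic _ _ _ _ _ hP) as hP'.
pose proof (poncelet_cyclic _ _ _ _ _ hP') as hP''.
pose proof (circumcenter_dist _ _ _ _ _ ha hb hP) as R1.
pose proof (circumcenter_dist _ _ _ _ _ ha hb hP') as R2.
pose proof (circumcenter_dist _ _ _ _ _ ha hb hP'') as R3.
replace (fst N2 + fst N3 + fst N1)
  with (fst N1 + fst N2 + fst N3) in R2 by ring.
replace (snd N2 + snd N3 + snd N1)
  with (snd N1 + snd N2 + snd N3) in R2 by ring.
replace (fst N3 + fst N1 + fst N2)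
  with (fst N1 + fst N2 + fst N3) in R3 by ring.
replace (snd N3 + snd N1 + snd N2)
  with (snd N1 + snd N2 + snd N3) in R3 by ring.
pose proof (circumcenter_bary _ _ _ _ _ _ _ _ _ _ _ _ R1 R2 R3
  (distance_sq (vertex a b N2) (vertex a b N3))
  (distance_sq (vertex a b N3) (vertex a b N1))
  (distance_sq (vertex a b N1) (vertex a b N2))) as [Cx Cy].
destruct (poncelet_incenter _ _ _ _ _ ha hb hP) as [Ix Iy].
destruct (poncelet_tangent_lengths _ _ _ _ _ ha hb hP)
  as (t1 & t2 & t3 & p1 & p2 & p3 & E1 & E2 & E3 & E).
unfold bary; cbn [V1 V2 V3].
rewrite E1, E2, E3 in *; clear E1 E2 E3 R1 R2 R3.
destruct (hc t1 t2 t3 p1 p2 p3 E) as [hW H1].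
destruct (hc t2 t3 t1 p2 p3 p1) as [_ H2]; [lra |].
destruct (hc t3 t1 t2 p3 p1 p2) as [_ H3]; [lra |].
set (h1 := h (t2 + t3) (t3 + t1) (t1 + t2)) in *.
set (h2 := h (t3 + t1) (t1 + t2) (t2 + t3)) in *.
set (h3 := h (t1 + t2) (t2 + t3) (t3 + t1)) in *.
replace (h2 + h3 + h1) with (h1 + h2 + h3) in H2 by ring.
replace (h3 + h1 + h2) with (h1 + h2 + h3) in H3 by ring.
set (W := h1 + h2 + h3) in *; clearbody W h1 h2 h3.
unfold padd, pscale, vertex; cbn [fst snd].
destruct N1 as [a1 b1], N2 as [a2 b2], N3 as [a3 b3]; cbn [fst snd] in *.
assert (hp : 0 < t1 * t2 * t3) by (repeat apply Rmult_lt_0_compat; lra).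
set (g1 :=
  (t2 + t3) ^ 2 * ((t3 + t1) ^ 2 + (t1 + t2) ^ 2 - (t2 + t3) ^ 2)) in *.
set (g2 :=
  (t3 + t1) ^ 2 * ((t1 + t2) ^ 2 + (t2 + t3) ^ 2 - (t3 + t1) ^ 2)) in *.
set (g3 :=
  (t1 + t2) ^ 2 * ((t2 + t3) ^ 2 + (t3 + t1) ^ 2 - (t1 + t2) ^ 2)) in *.
assert (G : g1 + g2 + g3 = 16 * (t1 + t2 + t3) * (t1 * t2 * t3))
  by (unfold g1, g2, g3; ring).
clearbody g1 g2 g3.
(* One coordinate at a time, [c] being [a] or [b]: the X1 part drops out by the incenter relation,
   and the X3 part is the circumcenter coordinate [V]. *)
assert (combine : forall c k1 k2 k3 V,
  (t2 + t3) * k1 + (t3 + t1) * k2 + (t1 + t2) * k3 = 0 ->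
  g1 * (c * k1) + g2 * (c * k2) + g3 * (c * k3) = (g1 + g2 + g3) * V ->
  / W * (h1 * (c * k1) + (h2 * (c * k2) + h3 * (c * k3))) =
  beta * (c / 3) * (k1 + k2 + k3) + gamma * V).
{ clear - hW H1 H2 H3 G hp p1 p2 p3; intros c k1 k2 k3 V I C.
  rewrite G in C.
  replace V with ((g1 * (c * k1) + g2 * (c * k2) + g3 * (c * k3))
    / (16 * (t1 + t2 + t3) * (t1 * t2 * t3))) by (rewrite C; field; lra).
  rewrite H1, H2, H3.
  transitivity (beta * (c / 3) * (k1 + k2 + k3)
    + gamma * ((g1 * (c * k1) + g2 * (c * k2) + g3 * (c * k3))
        / (16 * (t1 + t2 + t3) * (t1 * t2 * t3)))
    + (1 - beta - gamma) * c / (2 * (t1 + t2 + t3)) *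
      ((t2 + t3) * k1 + (t3 + t1) * k2 + (t1 + t2) * k3)).
  - field; repeat split; lra.
  - rewrite I; ring. }
assert (Hx := combine _ _ _ _ _ Ix Cx); assert (Hy := combine _ _ _ _ _ Iy Cy).
intros P; split; [intros [_ ->] | intros ->; split; [exact hW |]];
  rewrite Hx, Hy; unfold axis; f_equal; field.
Qed.

(** * Closure and the locus *)

(* [- N2] and [- N3] are the directions in which the two tangents from the first
   vertex touch the circle; that [N2] and [N3] are conjugate to each other is
   Poncelet's closure. *)
Lemma poncelet_closure (a b : R) (N1 : point) : 0 < a -> 0 < b -> unit_vector N1 ->
  exists N2 N3, poncelet a b N1 N2 N3.
Proof.
intros ha hb u1.
destruct (vertex_norm a b N1 ha hb u1) as [hM E].
pose proof (inradius_mult a b ha hb) as hr.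
pose proof (inradius_pos a b ha hb) as hr0.
destruct N1 as [p q]; unfold poncelet, unit_vector, conjugate in *; cbn [fst snd] in *.
set (r := inradius a b) in *; clearbody r.
set (x := a * p) in *; set (y := b * q) in *.
set (M := a * p ^ 2 + b * q ^ 2) in *.
set (L := x ^ 2 + y ^ 2) in *.
assert (hL : 0 < L) by (rewrite E; apply Rmult_lt_0_compat; lra).
(* The vertex lies outside the circle, because [r] is smaller than both semi-axes. *)
assert (hLr : r ^ 2 < L).
{ assert (h1 : r < a) by nra. assert (h2 : r < b) by nra.
  unfold L, x, y.
  assert (r ^ 2 * (p ^ 2 + q ^ 2) = r ^ 2) by (rewrite u1; ring).
  assert (r ^ 2 < a ^ 2) by nra. assert (r ^ 2 < b ^ 2) by nra.
  assert (0 < p ^ 2 \/ 0 < q ^ 2)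
    by (destruct (Rlt_dec 0 (p ^ 2)); [auto | right; nra]).
  pose proof (pow2_ge_0 p); pose proof (pow2_ge_0 q).
  nra. }
set (k := sqrt (L - r ^ 2) / L).
assert (hk : k ^ 2 * L = 1 - r ^ 2 / L).
{ unfold k, Rdiv; rewrite Rpow_mult_distr, pow2_sqrt by lra; field; lra. }
assert (hk0 : 0 < k).
{ apply Rdiv_lt_0_compat; [apply sqrt_lt_R0; lra | exact hL]. }
clearbody k.
(* The two unit vectors with scalar product [- r] with the vertex [(x, y)]: a common multiple of the
   vertex, plus or minus [k] times the vertex turned by a right angle. *)
exists (- r * x / L - k * y, - r * y / L + k * x),
       (- r * x / L + k * y, - r * y / L - k * x); cbn [fst snd].
assert (hu : (r * x / L) ^ 2 + (r * y / L) ^ 2 + k ^ 2 * L = 1).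
{ rewrite hk; transitivity (r ^ 2 * (x ^ 2 + y ^ 2) / L ^ 2 + 1 - r ^ 2 / L);
    [field; lra | fold L; field; lra]. }
assert (hc : x * (r * x / L) + y * (r * y / L) = r).
{ transitivity (r * (x ^ 2 + y ^ 2) / L); [field; lra | fold L; field; lra]. }
(* This is the conjugacy of [N2] and [N3], that is, the closing of the polygon. *)
assert (hc' : a * (r * x / L) ^ 2 + b * (r * y / L) ^ 2
  - k ^ 2 * (a * y ^ 2 + b * x ^ 2) = - r).
{ transitivity ((r ^ 2 * (a * x ^ 2 + b * y ^ 2) / L
    - k ^ 2 * L * (a * y ^ 2 + b * x ^ 2)) / L); [field; lra |].
  rewrite hk.
  transitivity ((r ^ 2 * (a + b) * (x ^ 2 + y ^ 2) / L
    - (a * y ^ 2 + b * x ^ 2)) / L); [field; lra |].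
  fold L; replace (a * y ^ 2 + b * x ^ 2) with (a * b * M)
    by (unfold x, y, M; ring).
  transitivity ((r * (r * (a + b)) - a * b * M) / L); [field; lra |].
  rewrite hr; rewrite E, <- hr; field; split; nra. }
assert (distinct : forall N, x * fst N + y * snd N = - r -> (p, q) <> N).
{ intros N EN <-; cbn [fst snd] in EN.
  assert (x * p + y * q = M) by (unfold x, y, M; ring); lra. }
unfold Rdiv in *.
repeat split.
- exact u1.
- rewrite <- hu; unfold L; ring.
- rewrite <- hu; unfold L; ring.
- apply distinct; cbn [fst snd]; lra.
- change (a * p) with x; change (b * q) with y; lra.
- intros E1; inversion E1 as [[E2 E3]].
  assert (k * y = 0) by lra; assert (k * x = 0) by lra.
  assert (y = 0) by nra; assert (x = 0) by nra; unfold L in hL; nra.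
- lra.
- apply not_eq_sym, distinct; cbn [fst snd]; lra.
- transitivity ((- r * x * / L + k * y) * x + (- r * y * / L - k * x) * y);
    [unfold x, y; ring | lra].
Qed.

Lemma antiperiodic_zero (f : R -> R) : continuity f ->
  (forall x, f (x + PI) = - f x) -> exists x, f x = 0.
Proof.
intros hf hPI.
assert (hsum : f (0 + PI) = - f 0) by apply hPI.
rewrite Rplus_0_l in hsum.
destruct (IVT_cor f 0 PI hf) as [z [_ hz]];
  [apply Rlt_le, PI_RGT_0 | rewrite hsum; nra | now exists z].
Qed.

(** The squared norms of the difference and of the sum of the two vectors multiply to a sum of
    squares of the two quantities assumed to vanish. *)
Lemma norm_parallel (x y x' y' : R) : x ^ 2 + y ^ 2 = x' ^ 2 + y' ^ 2 ->
  x * y' = x' * y -> x = x' /\ y = y' \/ x = - x' /\ y = - y'.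
Proof.
intros hn hpar.
assert (E : ((x - x') ^ 2 + (y - y') ^ 2) * ((x + x') ^ 2 + (y + y') ^ 2) = 0).
{ transitivity ((x ^ 2 + y ^ 2 - (x' ^ 2 + y' ^ 2)) ^ 2
    + 4 * (x * y' - x' * y) ^ 2); [ring |].
  rewrite hn, hpar; ring. }
apply Rmult_integral in E; destruct E as [E | E]; apply sum_sq_0 in E; lra.
Qed.

Lemma poncelet_opp (a b : R) (N1 N2 N3 : point) : poncelet a b N1 N2 N3 ->
  poncelet a b (pscale (-1) N1) (pscale (-1) N2) (pscale (-1) N3).
Proof.
assert (hu : forall N, unit_vector N -> unit_vector (pscale (-1) N)).
{ intros N; unfold unit_vector, pscale; cbn [fst snd]; intros <-; ring. }
assert (hc : forall N N', conjugate a b N N' ->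
  conjugate a b (pscale (-1) N) (pscale (-1) N')).
{ unfold conjugate, pscale; intros [p q] [p' q']; cbn [fst snd]; intros [hne <-].
  split; [| ring].
  intros E; inversion E; apply hne; f_equal; lra. }
intros (? & ? & ? & ? & ? & ?); repeat split; try apply hu; try apply hc; auto.
Qed.

(* With [N1 = (cos u, sin u)], turning [u] by [PI] reverses the sum, so by the
   intermediate value theorem the sum is parallel to [(P, Q)] for some [u]. *)
Lemma poncelet_with_center (a b P Q : R) : 0 < a -> 0 < b ->
  P ^ 2 + Q ^ 2 = ((a - b) / (a + b)) ^ 2 ->
  exists N1 N2 N3, poncelet a b N1 N2 N3 /\
  fst N1 + fst N2 + fst N3 = P /\ snd N1 + snd N2 + snd N3 = Q.
Proof.
intros ha hb hPQ.
set (r := inradius a b).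
set (m := fun u => (a + b) * (a * cos u ^ 2 + b * sin u ^ 2 - r)).
(* By [conjugate_sum], [f u / m u] is the cross product of the sum of normals with [(P, Q)]; since
   [m] has period [PI], [f] changes sign under that shift. *)
set (f := fun u =>
  cos u * (m u - 2 * r * a) * Q - sin u * (m u - 2 * r * b) * P).
destruct (antiperiodic_zero f) as [u hu].
{ unfold f, m; reg. }
{ intros u; unfold f, m; rewrite neg_cos, neg_sin; ring. }
assert (u1 : unit_vector (cos u, sin u)).
{ unfold unit_vector; cbn [fst snd]; rewrite <- (sin2_cos2 u), !Rsqr_pow2; ring. }
destruct (poncelet_closure a b _ ha hb u1) as (N2 & N3 & hP).
pose proof (center_norm _ _ _ _ _ ha hb hP) as hn.
destruct (conjugate_sum _ _ _ _ _ ha hb hP) as [E1 E2].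
destruct (vertex_norm a b _ ha hb u1) as [hM _].
cbn [fst snd] in E1, E2, hM; fold r in E1, E2, hM.
assert (hm : 0 < m u) by (apply Rmult_lt_0_compat; lra).
fold (m u) in E1, E2.
destruct (norm_parallel (fst (cos u, sin u) + fst N2 + fst N3)
  (snd (cos u, sin u) + snd N2 + snd N3) P Q) as [[F1 F2] | [F1 F2]].
- rewrite hPQ; exact hn.
- rewrite !Rplus_assoc, E1, E2; cbn [fst snd].
  apply Rminus_diag_uniq; transitivity (f u / m u).
  + unfold f; field; lra.
  + rewrite hu; field; lra.
- now exists (cos u, sin u), N2, N3.
- exists (pscale (-1) (cos u, sin u)), (pscale (-1) N2), (pscale (-1) N3).
  split; [now apply poncelet_opp |].
  unfold pscale; cbn [fst snd] in *; lra.
Qed.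

(** The locus is the image of the circle of radius [|g|] under scaling of the coordinates by [u] and
    [v]. [center_norm] keeps the sums on this circle, and [poncelet_with_center] shows that they
    fill it. *)
Lemma located_ellipse (a b : R) (Y : center) (beta gamma : R) :
  0 < a -> 0 < b -> a <> b -> located a b Y beta gamma ->
  axis beta gamma a b <> 0 -> axis beta gamma b a <> 0 ->
  (forall T : Triangle, incircle_family a b T -> exists P : point, Y T P) /\
  is_ellipse (locus a b Y).
Proof.
unfold located.
generalize (axis beta gamma a b) (axis beta gamma b a).
intros u v ha hb hab hY hu hv.
set (g := (a - b) / (a + b)).
assert (hg : g <> 0).
{ intros E; apply hab; apply (f_equal (fun t => t * (a + b))) in E.
  unfold g in E; field_simplify in E; lra. }
split.
- intros T hT; destruct (incircle_family_poncelet a b T ha hb hT)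
    as (N1 & N2 & N3 & hP & ->).
  eexists; apply (hY _ _ _ hP); reflexivity.
- exists (0, 0), (1, 0), (Rabs (u * g)), (Rabs (v * g)); cbn [fst snd].
  split; [ring |].
  split; [now apply Rabs_pos_lt, Rmult_integral_contrapositive |].
  split; [now apply Rabs_pos_lt, Rmult_integral_contrapositive |].
  intros [x y]; cbn [fst snd].
  unfold Rdiv; rewrite !Rpow_mult_distr, !pow_inv, !pow2_abs.
  replace (_ + _) with (((x / u) ^ 2 + (y / v) ^ 2) / g ^ 2) by (field; auto).
  split.
  + intros (T & hT & HT); destruct (incircle_family_poncelet a b T ha hb hT)
      as (N1 & N2 & N3 & hP & ->).
    apply (hY _ _ _ hP) in HT; injection HT as -> ->.
    pose proof (center_norm _ _ _ _ _ ha hb hP) as hn; fold g in hn.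
    assert (cancel : forall k t, k <> 0 -> k * t / k = t)
      by (intros; field; assumption).
    rewrite !cancel by assumption; rewrite hn; field; exact hg.
  + intros E.
    destruct (poncelet_with_center a b (x / u) (y / v) ha hb)
      as (N1 & N2 & N3 & hP & E1 & E2).
    { fold g; transitivity (((x / u) ^ 2 + (y / v) ^ 2) / g ^ 2 * g ^ 2);
        [field; auto | rewrite E; ring]. }
    exists (mkTriangle (vertex a b N1) (vertex a b N2) (vertex a b N3)).
    split; [now apply incircle_family_iff |].
    apply (hY _ _ _ hP); rewrite E1, E2; f_equal; field; auto.
Qed.

(** * The individual centers *)

(** Strict Euler inequality, which keeps denominators such as [r - 2] away from zero. *)
Lemma ratio_gt_2 (a b : R) : 0 < a -> 0 < b -> a <> b -> 2 < ratio a b.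
Proof.
intros ha hb hab; unfold ratio.
assert (0 < (a - b) ^ 2) by (rewrite <- Rsqr_pow2; apply Rsqr_pos_lt; lra).
assert (h : 0 < 2 * a * b) by (repeat apply Rmult_lt_0_compat; lra).
apply Rmult_lt_reg_r with (2 * a * b); [exact h |].
replace ((a + b) ^ 2 / (2 * a * b) * (2 * a * b)) with ((a + b) ^ 2)
  by (field; lra).
lra.
Qed.

(** Replacing [r] by its expression in the tangent lengths turns the constrained identity into one
    between rational functions of free variables, suited to [field]. *)
Lemma central_intro (r : R) (h : R -> R -> R -> R) (beta gamma : R)
  (W : R -> R -> R) : 2 < r ->
  (forall t1 t2 t3, 0 < t1 -> 0 < t2 -> 0 < t3 ->
    8 * (t1 * t2 * t3) < (t1 + t2) * (t2 + t3) * (t3 + t1) ->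
    r = (t1 + t2) * (t2 + t3) * (t3 + t1) / (4 * (t1 * t2 * t3)) ->
    let x := t2 + t3 in
    let y := t3 + t1 in
    let z := t1 + t2 in
    let V := W (t1 + t2 + t3) (t1 * t2 * t3) in
    V <> 0 /\
    h x y z + h y z x + h z x y = V /\
    h x y z = V * (beta / 3
      + gamma * (x ^ 2 * (y ^ 2 + z ^ 2 - x ^ 2))
        / (16 * (t1 + t2 + t3) * (t1 * t2 * t3))
      + (1 - beta - gamma) * x / (2 * (t1 + t2 + t3)))) ->
  central r h beta gamma.
Proof.
intros hr hW t1 t2 t3 p1 p2 p3 E x y z V.
assert (he : 0 < t1 * t2 * t3) by (repeat apply Rmult_lt_0_compat; lra).
destruct (hW t1 t2 t3 p1 p2 p3) as (hV & EV & Eh).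
- rewrite E; nra.
- rewrite E; field; lra.
- unfold V; fold x y z in EV, Eh; rewrite EV; auto.
Qed.

Ltac nonzero :=
  repeat split;
  repeat first [ apply Rmult_integral_contrapositive; split
               | apply Rinv_neq_0_compat ];
  try first [ assumption | lra | apply Rgt_not_eq; lra | apply Rlt_not_eq; lra ].

(* [W] expresses the sum of the coordinates by the semiperimeter [e1] and the
   product [e3] of the tangent lengths. *)
Ltac central W :=
  apply located_bary; [assumption.. |];
  match goal with
    hr : 2 < ?r |- central ?r' _ _ _ => change r' with r; clearbody r;
    apply central_intro with W; [exact hr |]
  end;
  intros t1 t2 t3 p1 p2 p3 hlt Er; cbv zeta;
  assert (0 < t1 + t2 + t3) by lra;
  assert (0 < t1 * t2 * t3) by (repeat apply Rmult_lt_0_compat; lra);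
  split; [clear Er | split; try rewrite Er; unfold kappa; field]; nonzero.

Lemma located_X1 (a b : R) (r := ratio a b) :
  0 < a -> 0 < b -> a <> b -> located a b X1 0 0.
Proof.
intros ha hb hab; pose proof (ratio_gt_2 a b ha hb hab : 2 < r).
central (fun e1 e3 : R => 2 * e1).
Qed.

Lemma located_X2 (a b : R) (r := ratio a b) :
  0 < a -> 0 < b -> a <> b -> located a b X2 1 0.
Proof.
intros ha hb hab; pose proof (ratio_gt_2 a b ha hb hab : 2 < r).
central (fun e1 e3 : R => 3).
Qed.

Lemma located_X3 (a b : R) (r := ratio a b) :
  0 < a -> 0 < b -> a <> b -> located a b X3 0 1.
Proof.
intros ha hb hab; pose proof (ratio_gt_2 a b ha hb hab : 2 < r).
central (fun e1 e3 : R => 16 * e1 * e3).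
Qed.

(** The constraint reads [e1 * e2 - e3 = 4 * r * e3] in the elementary symmetric functions of the
    tangent lengths, so [e2 = (1 + 4 * r) * e3 / e1]; hence the factor [1 + 4 * r] here and for
    X9. *)
Lemma located_X7 (a b : R) (r := ratio a b) :
  0 < a -> 0 < b -> a <> b ->
  located a b X7 (3 / (1 + 4 * r))
    (- 4 / (1 + 4 * r)).
Proof.
intros ha hb hab; pose proof (ratio_gt_2 a b ha hb hab : 2 < r).
central (fun e1 e3 : R => 4 * (1 + 4 * r) * e3 / e1).
Qed.

Lemma located_X8 (a b : R) (r := ratio a b) :
  0 < a -> 0 < b -> a <> b -> located a b X8 3 0.
Proof.
intros ha hb hab; pose proof (ratio_gt_2 a b ha hb hab : 2 < r).
central (fun e1 e3 : R => 2 * e1).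
Qed.

Lemma located_X9 (a b : R) (r := ratio a b) :
  0 < a -> 0 < b -> a <> b ->
  located a b X9 (6 * r / (1 + 4 * r))
    (2 / (1 + 4 * r)).
Proof.
intros ha hb hab; pose proof (ratio_gt_2 a b ha hb hab : 2 < r).
central (fun e1 e3 : R => 4 * (1 + 4 * r) * e3 / e1).
Qed.

Lemma located_X10 (a b : R) (r := ratio a b) :
  0 < a -> 0 < b -> a <> b -> located a b X10 (3 / 2) 0.
Proof.
intros ha hb hab; pose proof (ratio_gt_2 a b ha hb hab : 2 < r).
central (fun e1 e3 : R => 4 * e1).
Qed.

Lemma located_X11 (a b : R) (r := ratio a b) :
  0 < a -> 0 < b -> a <> b -> located a b X11 (- 3 / (r - 2)) (1 / (r - 2)).
Proof.
intros ha hb hab; pose proof (ratio_gt_2 a b ha hb hab : 2 < r).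
central (fun e1 e3 : R => 8 * (r - 2) * e3).
Qed.

Lemma located_X12 (a b : R) (r := ratio a b) :
  0 < a -> 0 < b -> a <> b -> located a b X12 (3 / (2 + r)) (- 1 / (2 + r)).
Proof.
intros ha hb hab; pose proof (ratio_gt_2 a b ha hb hab : 2 < r).
central (fun e1 e3 : R => 16 * (2 + r) * e1 * e3).
Qed.

Lemma located_X21 (a b : R) (r := ratio a b) :
  0 < a -> 0 < b -> a <> b ->
  located a b X21 (3 * r / (2 + 3 * r))
    (2 / (2 + 3 * r)).
Proof.
intros ha hb hab; pose proof (ratio_gt_2 a b ha hb hab : 2 < r).
central (fun e1 e3 : R => 8 * (2 + 3 * r) * e1 * e3).
Qed.

Lemma located_X35 (a b : R) (r := ratio a b) :
  0 < a -> 0 < b -> a <> b -> located a b X35 0 (2 / (2 + r)).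
Proof.
intros ha hb hab; pose proof (ratio_gt_2 a b ha hb hab : 2 < r).
central (fun e1 e3 : R => 2 * (2 + r) * e1 / r).
Qed.

Lemma located_X36 (a b : R) (r := ratio a b) :
  0 < a -> 0 < b -> a <> b -> located a b X36 0 (- 2 / (r - 2)).
Proof.
intros ha hb hab; pose proof (ratio_gt_2 a b ha hb hab : 2 < r).
central (fun e1 e3 : R => 2 * (r - 2) * e1 / r).
Qed.

Lemma located_X46 (a b : R) (r := ratio a b) :
  0 < a -> 0 < b -> a <> b -> located a b X46 0 (- 2 / (r - 1)).
Proof.
intros ha hb hab; pose proof (ratio_gt_2 a b ha hb hab : 2 < r).
central (fun e1 e3 : R => 2 * (r - 1) * e1 / r).
Qed.

Lemma located_X55 (a b : R) (r := ratio a b) :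
  0 < a -> 0 < b -> a <> b -> located a b X55 0 (1 / (1 + r)).
Proof.
intros ha hb hab; pose proof (ratio_gt_2 a b ha hb hab : 2 < r).
central (fun e1 e3 : R => 8 * (1 + r) * e3).
Qed.

Lemma located_X56 (a b : R) (r := ratio a b) :
  0 < a -> 0 < b -> a <> b -> located a b X56 0 (- 1 / (r - 1)).
Proof.
intros ha hb hab; pose proof (ratio_gt_2 a b ha hb hab : 2 < r).
central (fun e1 e3 : R => 16 * (r - 1) * e1 * e3).
Qed.

Lemma located_X57 (a b : R) (r := ratio a b) :
  0 < a -> 0 < b -> a <> b -> located a b X57 0 (- 2 / (2 * r - 1)).
Proof.
intros ha hb hab; pose proof (ratio_gt_2 a b ha hb hab : 2 < r).
central (fun e1 e3 : R => 8 * (2 * r - 1) * e3).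
Qed.

Lemma located_X63 (a b : R) (r := ratio a b) :
  0 < a -> 0 < b -> a <> b -> located a b X63 (3 * r / (1 + r)) (2 / (1 + r)).
Proof.
intros ha hb hab; pose proof (ratio_gt_2 a b ha hb hab : 2 < r).
central (fun e1 e3 : R => 8 * (1 + r) * e3).
Qed.

Lemma located_X65 (a b : R) (r := ratio a b) :
  0 < a -> 0 < b -> a <> b -> located a b X65 0 (- 1 / r).
Proof.
intros ha hb hab; pose proof (ratio_gt_2 a b ha hb hab : 2 < r).
central (fun e1 e3 : R => 16 * r * e1 * e3).
Qed.

Lemma located_X72 (a b : R) (r := ratio a b) :
  0 < a -> 0 < b -> a <> b -> located a b X72 3 (1 / r).
Proof.
intros ha hb hab; pose proof (ratio_gt_2 a b ha hb hab : 2 < r).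
central (fun e1 e3 : R => 16 * r * e1 * e3).
Qed.

Lemma located_X78 (a b : R) (r := ratio a b) :
  0 < a -> 0 < b -> a <> b -> located a b X78 (3 * r / (r - 1)) 0.
Proof.
intros ha hb hab; pose proof (ratio_gt_2 a b ha hb hab : 2 < r).
central (fun e1 e3 : R => 16 * (r - 1) * e1 * e3).
Qed.

Lemma located_X79 (a b : R) (r := ratio a b) :
  0 < a -> 0 < b -> a <> b ->
  located a b X79 (6 / (2 + 3 * r))
    (- 6 / (2 + 3 * r)).
Proof.
intros ha hb hab; pose proof (ratio_gt_2 a b ha hb hab : 2 < r).
central (fun e1 e3 : R => 8 * (2 + 3 * r) * e1 * e3).
Qed.

Lemma located_X84 (a b : R) (r := ratio a b) :
  0 < a -> 0 < b -> a <> b -> located a b X84 (6 * r) (2 - 4 * r).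
Proof.
intros ha hb hab; pose proof (ratio_gt_2 a b ha hb hab : 2 < r).
central (fun e1 e3 : R => 2 * e1 / (r * r)).
Qed.

(** For [r > 2] the quadratic vanishes only at [1 + sqrt 2], the ratio of a right isosceles
    triangle; there the coordinates sum to zero. *)
Lemma located_X90 (a b : R) (r := ratio a b) :
  0 < a -> 0 < b -> a <> b -> r ^ 2 - 2 * r - 1 <> 0 ->
 
  located a b X90 (- 6 * r / (r ^ 2 - 2 * r - 1))
    (2 * (r - 1) / (r ^ 2 - 2 * r - 1)).
Proof.
intros ha hb hab hq; pose proof (ratio_gt_2 a b ha hb hab : 2 < r).
central (fun e1 e3 : R => - 2 * (r ^ 2 - 2 * r - 1) * e1 / (r * r)).
(* The side condition left by [field] is [hq] written in tangent lengths with denominators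
   cleared. *)
intros E; apply hq; rewrite Er.
match type of E with ?l = 0 => transitivity (l / (4 * (t1 * t2 * t3)) ^ 2) end.
- field; nonzero.
- rewrite E; field; nonzero.
Qed.

Lemma located_X200 (a b : R) (r := ratio a b) :
  0 < a -> 0 < b -> a <> b -> located a b X200 (6 * r / (2 * r - 1)) 0.
Proof.
intros ha hb hab; pose proof (ratio_gt_2 a b ha hb hab : 2 < r).
central (fun e1 e3 : R => 8 * (2 * r - 1) * e3).
Qed.

(** [U] is a simplified form of [axis] whose factors are visibly nonzero; exchanging its arguments
    serves the other axis. *)
Lemma axis_ellipse (U : R -> R -> R) (a b : R) (Y : center) (beta gamma : R) :
  0 < a -> 0 < b -> a <> b -> located a b Y beta gamma ->
  axis beta gamma a b = U a b -> axis beta gamma b a = U b a ->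
  U a b <> 0 -> U b a <> 0 ->
  (forall T : Triangle, incircle_family a b T -> exists P : point, Y T P) /\
  is_ellipse (locus a b Y).
Proof.
intros ha hb hab hY E E' hU hU'.
apply located_ellipse with beta gamma; rewrite ?E, ?E'; assumption.
Qed.

(** The form is [(a + b) ^ 2 - 2 * b ^ 2], a difference of squares with one positive factor and one
    excluded by the hypothesis. *)
Lemma ratio_sqrt2 (a b : R) : 0 < a -> 0 < b -> a <> (sqrt 2 - 1) * b ->
  a ^ 2 + 2 * a * b - b ^ 2 <> 0.
Proof.
intros ha hb hne E.
pose proof (sqrt_sqrt 2 ltac:(lra)) as hs; pose proof (sqrt_pos 2).
assert (F : (a + b - sqrt 2 * b) * (a + b + sqrt 2 * b) = 0).
{ transitivity (a ^ 2 + 2 * a * b - b ^ 2 + (2 - sqrt 2 * sqrt 2) * b ^ 2);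
    [ring | rewrite hs, E; ring]. }
apply Rmult_integral in F; destruct F as [F | F]; [apply hne; lra | nra].
Qed.

(** Unification supplies the coefficients; centers defined by [comb] reach the last branch and are
    resolved recursively. *)
Ltac locate :=
  first
    [ eapply located_X1; eassumption
    | eapply located_X2; eassumption
    | eapply located_X3; eassumption
    | eapply located_X7; eassumption
    | eapply located_X8; eassumption
    | eapply located_X9; eassumption
    | eapply located_X10; eassumption
    | eapply located_X11; eassumption
    | eapply located_X12; eassumption
    | eapply located_X21; eassumption
    | eapply located_X35; eassumption
    | eapply located_X36; eassumption
    | eapply located_X46; eassumption
    | eapply located_X55; eassumption
    | eapply located_X56; eassumption
    | eapply located_X57; eassumption
    | eapply located_X63; eassumption
    | eapply located_X65; eassumption
    | eapply located_X72; eassumption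
    | eapply located_X78; eassumption
    | eapply located_X79; eassumption
    | eapply located_X84; eassumption
    | eapply located_X90; eassumption
    | eapply located_X200; eassumption
    | match goal with |- located _ _ ?Y _ _ => unfold Y end;
      eapply located_comb; locate ].

(* [u a b], [u b a] are the factors that take the circle described by the sum of
   the unit vectors to the locus. *)
Ltac ellipse u :=
  cbn [X]; eapply axis_ellipse with (U := u);
  [ assumption | assumption | assumption | locate
  | unfold axis, ratio; field; nonzero
  | unfold axis, ratio; field; nonzero
  | unfold Rdiv; nonzero | unfold Rdiv; nonzero ].

Theorem proposition5 (a b : R) (k : nat)
  (ha : 0 < a) (hb : 0 < b) (hab : a <> b)
  (hk : In k [2; 3; 4; 5; 7; 8; 9; 10; 11; 12; 20; 21; 35; 36; 40; 46; 55; 56;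
              57; 63; 65; 72; 78; 79; 80; 84; 90; 100; 104; 119; 140; 142; 144;
              145; 149; 153; 165; 191; 200]%nat)
  (h90 : k = 90%nat -> b <> (sqrt 2 - 1) * a /\ a <> (sqrt 2 - 1) * b) :
  (forall T : Triangle, incircle_family a b T -> exists P : point, X k T P) /\
  is_ellipse (locus a b (X k)).
Proof.
(* These quadratic facts let [lra] inside [nonzero] settle the signs of the denominators. *)
assert (0 < a * b) by (apply Rmult_lt_0_compat; assumption).
assert (0 < a ^ 2) by (apply pow_lt; assumption).
assert (0 < b ^ 2) by (apply pow_lt; assumption).
assert (0 < (a - b) ^ 2) by (rewrite <- Rsqr_pow2; apply Rsqr_pos_lt; lra).
repeat destruct hk as [<- | hk]; [.. | contradiction].
- ellipse (fun a b : R => a / 3).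
- ellipse (fun a b : R => (a + b) / 2).
- ellipse (fun a b : R => - b).
- ellipse (fun a b : R => (a - b) / 4).
- ellipse (fun a b : R => - (a * b) / (2 * a + b)).
- ellipse (fun a b : R => a).
- ellipse (fun a b : R => a * (a + b) / (2 * a + b)).
- ellipse (fun a b : R => a / 2).
- ellipse (fun a b : R => a * b / (b - a)).
- ellipse (fun a b : R => a * b * (a - b) / (a ^ 2 + 6 * a * b + b ^ 2)).
- ellipse (fun a b : R => a + 2 * b).
- ellipse (fun a b : R => a * (a + b) / (3 * a + b)).
- ellipse (fun a b : R => 2 * a * b * (a + b) / (a ^ 2 + 6 * a * b + b ^ 2)).
- ellipse (fun a b : R => - (2 * a * b) * (a + b) / ((a - b) * (a - b))).
- ellipse (fun a b : R => a + b).
- ellipse (fun a b : R => - (2 * a * b) * (a + b) / (a ^ 2 + b ^ 2)).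
- ellipse (fun a b : R => a * b * (a + b) / (a ^ 2 + 4 * a * b + b ^ 2)).
- ellipse (fun a b : R => - (a * b) * (a + b) / (a ^ 2 + b ^ 2)).
- ellipse (fun a b : R => - (a * b) * (a + b) / (a ^ 2 + a * b + b ^ 2)).
- ellipse (fun a b : R =>
    a * (a + b) * (a + 3 * b) / (a ^ 2 + 4 * a * b + b ^ 2)).
- ellipse (fun a b : R => - (a * b) / (a + b)).
- ellipse (fun a b : R => a * (a + 2 * b) / (a + b)).
- ellipse (fun a b : R => a * ((a + b) * (a + b)) / (a ^ 2 + b ^ 2)).
- ellipse (fun a b : R => - (2 * a * b) / (3 * a + b)).
- ellipse (fun a b : R => 2 * a * b / (b - a)).
- ellipse (fun a b : R => - (a + b) * b / a).
- destruct (h90 eq_refl) as [hba hab'].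
  assert (hq : a ^ 2 - 2 * a * b - b ^ 2 <> 0).
  { intros E; apply (ratio_sqrt2 b a hb ha hba); lra. }
  assert (hq' : b ^ 2 - 2 * b * a - a ^ 2 <> 0).
  { intros E; apply (ratio_sqrt2 a b ha hb hab'); lra. }
  (* The numerator splits into two quadratic forms, exchanged up to order with [a] and [b]; each
     semi-axis keeps one of them in its denominator. *)
  assert (hr : ratio a b ^ 2 - 2 * ratio a b - 1 <> 0).
  { replace (ratio a b ^ 2 - 2 * ratio a b - 1) with
      (- (a ^ 2 - 2 * a * b - b ^ 2) * (b ^ 2 - 2 * b * a - a ^ 2)
        / (2 * a * b * (2 * a * b))) by (unfold ratio; field; nonzero).
    unfold Rdiv; nonzero. }
  ellipse (fun a b : R =>
      - (2 * a * b) * (a + b) / (a ^ 2 - 2 * a * b - b ^ 2)).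
  all: intros E; apply
    (Rmult_integral_contrapositive_currified _ _ hq hq');
    lra.
- ellipse (fun a b : R => (a + b) * a / (a - b)).
- ellipse (fun a b : R => (a + b) * b / (b - a)).
- ellipse (fun a b : R => (a ^ 2 + b ^ 2) / (2 * (a - b))).
- ellipse (fun a b : R => (3 * a + b) / 8).
- ellipse (fun a b : R => a * a / (2 * (2 * a + b))).
- ellipse (fun a b : R => a * (2 * a + 3 * b) / (2 * a + b)).
- ellipse (fun a b : R => - a).
- ellipse (fun a b : R => a * (a + 3 * b) / (b - a)).
- ellipse (fun a b : R => (a ^ 2 + a * b + 2 * b ^ 2) / (a - b)).
- ellipse (fun a b : R => 2 * (a + b) / 3).
- ellipse (fun a b : R => 2 * a * (a + b) / (3 * a + b)).
- ellipse (fun a b : R => a * ((a + b) * (a + b)) / (a ^ 2 + a * b + b ^ 2)).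
Qed.
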